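(* For every compact set $\mathcal{A}\subset[-1,1]^d$ that spans $\mathbb{R}^d$, $$H_*^2\le\mathcal{C}_{\min}^{-1}\le d\,H_*^2 .$$ Furthermore, each of the two inequalities is tight up to a constant factor for some arm sets: there are absolute constants $c,C>0$ such that for every $d\ge1$ there exist a compact spanning set $\mathcal{A}\subset[-1,1]^d$ with $\mathcal{C}_{\min}^{-1}\le C\,H_*^2$, and a compact spanning set $\mathcal{A}'\subset[-1,1]^d$ with $\mathcal{C}_{\min}^{-1}\ge c\,d\,H_*^2$ (where in each case $H_*^2$ and $\mathcal{C}_{\min}$ are computed for the set in question).
   Context: For a probability measure $\mu$ on $\mathcal{A}$ let $Q(\mu)=\int_{\mathcal{A}}aa^\top d\mu(a)$, and let $\mathcal{P}(\mathcal{A})$ be the set of all Borel probability measures on $\mathcal{A}$. Define $$H_*^2:=\min_{\mu\in\mathcal{P}(\mathcal{A})}\max_{i\in[d]}(Q(\mu)^{-1})_{ii}$$ (the objective being $+\infty$ when $Q(\mu)$ is singular) and $$\mathcal{C}_{\min}:=\max_{\mu\in\mathcal{P}(\mathcal{A})}\lambda_{\min}(Q(\mu)),$$ where $\lambda_{\min}$ is the minimum eigenvalue. *)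

(* Defs.v *)
From mathcomp Require Import all_boot all_order all_algebra.
From mathcomp Require Import all_classical all_reals all_analysis.
Set Implicit Arguments.
Unset Strict Implicit.
Unset Printing Implicit Defensive.
Import Order.TTheory GRing.Theory Num.Theory.
Import numFieldNormedType.Exports.
Local Open Scope classical_set_scope.
Local Open Scope ring_scope.

(* 'cV[R]_d carries the product topology. *)
Definition borelRd (R : realType) (d : nat) :=
  g_sigma_algebraType (@open 'cV[R]_d).

Definition cube (R : realType) (d : nat) : set 'cV[R]_d :=
  [set a | forall i : 'I_d, -1 <= a i 0 <= 1].
Arguments cube R d : clear implicits.

Definition spanning (R : realType) (d : nat) (A : set 'cV[R]_d) : Prop :=
  forall v : 'cV[R]_d, exists2 s : seq 'cV[R]_d,
    (forall a, a \in s -> A a) & v \in span s.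

Definition arm_set (R : realType) (d : nat) (A : set 'cV[R]_d) : Prop :=
  [/\ compact A, A `<=` cube R d & spanning A].

(* For a Borel set A (in particular a compact one), the Borel probability
   measures on A are the Borel probability measures on R^d of mass 1 on A. *)
Definition prob_on (R : realType) (d : nat) (A : set 'cV[R]_d)
    : set (probability (borelRd R d) R) :=
  [set mu | mu A = 1%E].

Definition Qmx (R : realType) (d : nat) (A : set 'cV[R]_d)
    (mu : probability (borelRd R d) R) : 'M[R]_d :=
  \matrix_(i, j)
    (\int[mu]_(a in A) ((a : 'cV[R]_d) *m (a : 'cV[R]_d)^T) i j).

(* Real symmetric matrices of positive dimension have finitely many and at
   least one real eigenvalue, so that this infimum is a minimum for them. *)
Definition lambda_min (R : realType) (d : nat) (M : 'M[R]_d) : R :=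
  inf [set l | eigenvalue M l].

Definition max_diag_inv (R : realType) (d : nat) (M : 'M[R]_d) : \bar R :=
  if M \in unitmx then
    \big[Order.max/-oo%E]_(i < d) ((invmx M i i)%:E)
  else +oo%E.

Definition H_values (R : realType) (d : nat) (A : set 'cV[R]_d) : set (\bar R) :=
  [set max_diag_inv (Qmx A mu) | mu in prob_on A].

Definition C_values (R : realType) (d : nat) (A : set 'cV[R]_d) : set (\bar R) :=
  [set (lambda_min (Qmx A mu))%:E | mu in prob_on A].

(* The infimum (resp. supremum) is a minimum (resp. maximum) exactly when it
   belongs to the set of values. *)
Definition Hstar2 (R : realType) (d : nat) (A : set 'cV[R]_d) : \bar R :=
  ereal_inf (H_values A).

Definition Cmin (R : realType) (d : nat) (A : set 'cV[R]_d) : \bar R :=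
  ereal_sup (C_values A).

(* Main.v *)
Require Import Defs.
From mathcomp Require Import all_boot all_order all_algebra all_fingroup.
From mathcomp Require Import all_classical all_reals all_analysis.
From mathcomp Require Import measurable_realfun ring lra.
Import Order.TTheory GRing.Theory Num.Theory.
Import numFieldNormedType.Exports.
Local Open Scope classical_set_scope.
Local Open Scope ring_scope.

(* Both objectives depend on mu only through Q(mu), and the matrices Q(mu) are
   exactly the finite convex combinations of the a a^T with a in A: finite
   combinations are discrete measures, and conversely the projection of Q(mu)
   on the convex hull (compact, by Caratheodory) is Q(mu) itself, as one sees by
   integrating the obtuse angle inequality.  On this hull, for M positive
   semidefinite,
     lambda_min M >= t          iff  t |v|^2 <= v M v^T for all v,
     max_i (M^-1)_ii <= t       iff  v_i^2 <= t (v M v^T) for all i and v,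
   so that both optima are attained on a compact set, and the two inequalities
   follow from v_i^2 <= |v|^2 = sum_i v_i^2.
   The first one is an equality for the standard basis.  The second one is tight
   up to 4 for the standard basis together with all permutations of the
   alternating sign vector: the coordinates of all arms sum to at most 1 in
   absolute value, so that the all-ones direction forces C_min <= 1/d, whereas
   averaging the permutations identifies the coordinates of every v up to their
   mean, for which the basis vectors are good enough. *)

Set Implicit Arguments.
Unset Strict Implicit.
Unset Printing Implicit Defensive.

(** * Minima over compact sets *)

Section attainment.
Context {R : realType} {T : topologicalType}.

Lemma continuous_sum (K : numFieldType) (V : normedModType K) (I : finType)
    (F : I -> T -> V) :
  (forall i, continuous (F i)) -> continuous (fun x => \sum_i F i x).
Proof.
by move=> cF; apply: continuous_big => [|i _]; [exact: add_continuous|exact: cF].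
Qed.

Lemma continuous_mul (f g : T -> R) :
  continuous f -> continuous g -> continuous (fun x => f x * g x).
Proof. by move=> cf cg x; apply: cvgM; [exact: cf|exact: cg]. Qed.

(** Lower semicontinuity enters only through closed real sublevel sets, which suits [max_diag_inv]:
    it is [+oo] at singular matrices, and its sublevel sets are given by inequalities. The nonempty
    sublevel sets form a filter base on [K], and a cluster point lies in all of them. *)
Lemma compact_closed_sublevel_min (K : set T) (f : T -> \bar R) :
  compact K -> K !=set0 ->
  (forall t : R, closed [set x | K x /\ (f x <= t%:E)%E]) ->
  exists2 x, K x & forall y, K y -> (f x <= f y)%E.
Proof.
move=> cK [x0 Kx0] clf; pose B t := [set x | K x /\ (f x <= t%:E)%E].
pose D := [set t | B t !=set0].
have [[t0 Dt0]|D0] := pselect (D !=set0); last first.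
  (* Without a nonempty real sublevel set, [f] is [+oo] on all of [K], so any point is a
     minimizer. *)
  exists x0 => // y Ky; case fy : (f y) => [r| |]; last 2 first.
  - by rewrite leey.
  - by exfalso; apply: D0; exists 0, y; split; rewrite // fy leNye.
  - by exfalso; apply: D0; exists r, y; split; rewrite // fy.
have FF : ProperFilter (filter_from D B).
  apply: filter_from_proper; last by [].
  apply: filter_from_filter; first by exists t0.
  move=> s t Ds Dt; exists (Num.min s t).
    by case: leP.
  move=> x [Kx]; rewrite EFin_min le_min => /andP[fs ft].
  by split.
have [p [Kp clp]] : K `&` cluster (filter_from D B) !=set0.
  by apply: cK; exists t0 => // x [].
have fp t : D t -> (f p <= t%:E)%E.
  move=> Dt; suff [] : B t p by [].
  by apply: (clf t) => U nU; apply: clp => //; exists t.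
exists p => // y Ky; case fy : (f y) => [r| |]; last 2 first.
- by rewrite leey.
- have fpt t : (f p <= t%:E)%E by apply: fp; exists y; split; rewrite // fy leNye.
  case: (f p) fpt => [r fpt| /(_ 0)|//]; last by rewrite leye_eq.
  by have := fpt (r - 1); rewrite lee_fin leNgt ltrBlDr ltrDl ltr01.
- by apply: fp; exists y; split; rewrite // fy.
Qed.

End attainment.

(** * Quadratic forms *)

Section bilinear_form.
Context {R : realType} {d : nat}.
Implicit Types (M : 'M[R]_d) (u v : 'rV[R]_d) (t : R).

(** Test vectors are rows because [eigenvalue] refers to row eigenvectors; arms remain columns. *)
Definition bform M u v : R := (u *m M *m v^T) 0 0.
Definition qform M v : R := bform M v v.
Definition sqnorm v : R := qform 1%:M v.
Definition psd M := M^T = M /\ forall v, 0 <= qform M v.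

Lemma bformDl M u u' v : bform M (u + u') v = bform M u v + bform M u' v.
Proof. by rewrite /bform !mulmxDl mxE. Qed.

Lemma bformDr M u v v' : bform M u (v + v') = bform M u v + bform M u v'.
Proof. by rewrite /bform linearD/= mulmxDr mxE. Qed.

Lemma bformZl M t u v : bform M (t *: u) v = t * bform M u v.
Proof. by rewrite /bform -!scalemxAl mxE. Qed.

Lemma bformZr M t u v : bform M u (t *: v) = t * bform M u v.
Proof. by rewrite /bform linearZ/= -scalemxAr mxE. Qed.

Lemma bformC M u v : M^T = M -> bform M u v = bform M v u.
Proof.
move=> Ms; rewrite /bform -[in LHS](trmxK (u *m M *m v^T)) mxE.
by rewrite !trmx_mul trmxK Ms mulmxA.
Qed.

Lemma qformE M v : qform M v = \sum_i \sum_j v 0 i * M i j * v 0 j.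
Proof.
rewrite /qform /bform mxE exchange_big/=; apply: eq_bigr => j _.
by rewrite !mxE mulr_suml; apply: eq_bigr => i _; rewrite mulrC.
Qed.

Lemma sqnormE v : sqnorm v = \sum_i v 0 i ^+ 2.
Proof.
rewrite /sqnorm /qform /bform mulmx1 mxE; apply: eq_bigr => i _.
by rewrite mxE expr2.
Qed.

Lemma qformZ M t v : qform M (t *: v) = t ^+ 2 * qform M v.
Proof. by rewrite /qform bformZl bformZr mulrA -expr2. Qed.

Lemma sqr_coord_le_sqnorm v i : v 0 i ^+ 2 <= sqnorm v.
Proof.
by rewrite sqnormE (bigD1 i)//= lerDl sumr_ge0// => j _; rewrite sqr_ge0.
Qed.

Lemma sqnorm_ge0 v : 0 <= sqnorm v.
Proof. by rewrite sqnormE sumr_ge0// => j _; rewrite sqr_ge0. Qed.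

Lemma sqnorm_gt0 v : (0 < sqnorm v) = (v != 0).
Proof.
rewrite lt_def sqnorm_ge0 andbT; congr (~~ _); apply/eqP/eqP => [v0|->].
  apply/rowP => i; rewrite mxE; apply/eqP; rewrite -sqrf_eq0 eq_le sqr_ge0.
  by rewrite -[X in _ <= X]v0 sqr_coord_le_sqnorm.
by rewrite sqnormE big1// => i _; rewrite mxE expr0n.
Qed.

Lemma psd_cauchy_schwarz M u v : psd M ->
  bform M u v ^+ 2 <= qform M u * qform M v.
Proof.
move=> [Ms M0]; set b := bform M u v.
have H s t : 0 <= s ^+ 2 * qform M u + 2 * s * t * b + t ^+ 2 * qform M v.
  have := M0 (s *: u + t *: v).
  rewrite /qform !(bformDl, bformDr) !(bformZl, bformZr) (bformC v u Ms) -/b.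
  by rewrite -/(qform M u) -/(qform M v); congr (0 <= _); ring.
have := M0 u; have := M0 v; move: (qform M u) (qform M v) H => p q H q0 p0.
have [p_gt0|] := ltP 0 p.
  (* The pair [(- b, p)] minimizes the binary form [H] in [s] up to scaling, which produces the
     discriminant. *)
  have := H (- b) p; rewrite (_ : _ + _ = p * (p * q - b ^+ 2)); last by ring.
  by rewrite pmulr_rge0// subr_ge0.
move=> p_le0; have p_eq0 : p = 0 by lra.
rewrite p_eq0 mul0r; have [->|b0] := eqVneq b 0; first by rewrite expr0n.
(* With [p = 0] the form is affine in [s]; this choice gives it the value [- q - 2], which is
   negative. *)
have := H (- (q + 1) / b) 1; rewrite p_eq0 mulr1 -(mulrA 2) divfK//.
by rewrite mulr0 expr1n mul1r => h; lra.
Qed.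

(** Cauchy-Schwarz against [v *m M] itself bounds the square of [sqnorm (v *m M)] by 0. *)
Lemma psd_isotropic M v : psd M -> qform M v = 0 -> v *m M = 0.
Proof.
move=> pM v0; apply/eqP; apply: contraT; rewrite -sqnorm_gt0 => vM_gt0.
have := psd_cauchy_schwarz v (v *m M) pM; rewrite v0 mul0r.
rewrite (_ : bform M v (v *m M) = sqnorm (v *m M)); last first.
  by rewrite /bform /sqnorm /qform /bform mulmx1.
by rewrite leNgt exprn_gt0.
Qed.

Lemma sqnorm_delta (i : 'I_d) : sqnorm (delta_mx 0 i) = 1.
Proof.
rewrite sqnormE (bigD1 i)//= mxE !eqxx expr1n big1 ?addr0// => j /negbTE ji.
by rewrite mxE ji andbF expr0n.
Qed.

Lemma qform_delta M i : qform M (delta_mx 0 i) = M i i.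
Proof. by rewrite /qform /bform -rowE trmx_delta -colE !mxE. Qed.

Lemma qformB M N v : qform (M - N) v = qform M v - qform N v.
Proof. by rewrite /qform /bform mulmxBr mulmxBl !mxE. Qed.

Lemma qform_scalar t v : qform t%:M v = t * sqnorm v.
Proof.
by rewrite /sqnorm /qform /bform mul_mx_scalar mulmx1 -scalemxAl mxE.
Qed.

Lemma bform_invmx_delta M i v : M \in unitmx ->
  bform M (delta_mx 0 i *m invmx M) v = v 0 i.
Proof. by move=> Mu; rewrite /bform mulmxKV// -rowE !mxE. Qed.

(** The [i]-th row of the inverse represents the [i]-th coordinate with respect to the form of [M],
    and its own value under that form is the diagonal entry. Cauchy-Schwarz with this row gives one
    direction; taking the row as [v] gives the other. *)
Lemma max_diag_inv_leP M t : (0 < d)%N -> psd M ->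
  ((max_diag_inv M <= t%:E)%E <-> forall i v, v 0 i ^+ 2 <= t * qform M v).
Proof.
move=> d0 pM; have [Ms M0] := pM; split.
  rewrite /max_diag_inv; case: ifPn => [Mu|_]; last by rewrite leye_eq.
  move=> /bigmax_leP[_ diag_le] i v.
  have := psd_cauchy_schwarz (delta_mx 0 i *m invmx M) v pM.
  rewrite /qform !bform_invmx_delta// -rowE mxE => h.
  apply: le_trans h _; rewrite ler_wpM2r//; first exact: M0.
  by have := diag_le i isT; rewrite lee_fin.
(* A vector in the kernel has all its coordinates bounded by 0. *)
move=> ht; have Mu : M \in unitmx.
  rewrite -row_free_unit; apply: inj_row_free => v vM0.
  apply/rowP => i; rewrite mxE; apply/eqP; rewrite -sqrf_eq0 eq_le sqr_ge0.
  by rewrite (le_trans (ht i v))// /qform /bform vM0 mul0mx mxE mulr0.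
rewrite /max_diag_inv Mu; apply/bigmax_leP; split => [|i _].
  by rewrite leNye.
(* For [g] the diagonal entry of the inverse, this instance reads [g ^+ 2 <= t * g], hence [g <= t]
   once [t] is positive. *)
rewrite lee_fin; have := ht i (delta_mx 0 i *m invmx M).
rewrite /qform bform_invmx_delta// -rowE mxE; move: (invmx M i i : R) => g hg.
have t_gt0 : 0 < t.
  have := ht i (delta_mx 0 i); have := M0 (delta_mx 0 i).
  by rewrite mxE !eqxx expr1n; nra.
by have [//|tg] := leP g t; clear -hg t_gt0 tg; nra.
Qed.

Lemma qform_continuous M : continuous (qform M).
Proof.
rewrite (_ : qform M = fun v => \sum_i \sum_j v 0 i * M i j * v 0 j).
  apply: continuous_sum => i; apply: continuous_sum => j.
  apply: continuous_mul; last exact: coord_continuous.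
  by apply: continuous_mul; [exact: coord_continuous|exact: cst_continuous].
by apply/funext => v; rewrite qformE.
Qed.

Lemma qform_continuousl v : continuous (fun M => qform M v).
Proof.
rewrite (_ : (fun M => _) = fun M => \sum_i \sum_j v 0 i * M i j * v 0 j).
  apply: continuous_sum => i; apply: continuous_sum => j.
  apply: continuous_mul; last exact: cst_continuous.
  by apply: continuous_mul; [exact: cst_continuous|exact: coord_continuous].
by apply/funext => M; rewrite qformE.
Qed.

(** The vector minimizes the quadratic form on the unit sphere, which is compact, and nonempty since
    [d] is positive. *)
Lemma lambda_min_attained M : (0 < d)%N -> psd M ->
  exists2 v, sqnorm v = 1 &
    lambda_min M = qform M v /\ forall u, qform M v * sqnorm u <= qform M u.
Proof.
move=> d0 pM; pose S := [set v : 'rV[R]_d | sqnorm v = 1].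
have cS : compact S.
  apply: bounded_closed_compact.
    exists 1; split; first exact: num_real.
    move=> x x1 v; rewrite /S/= => v1; apply: le_trans (ltW x1).
    rewrite [leLHS]/Num.Def.normr/= mx_normrE; apply/bigmax_leP; split => // -[i j] _ /=.
    rewrite ord1 -(@ler_pXn2r _ 2)// ?nnegrE// expr1n -normrX ger0_norm ?sqr_ge0//.
    by rewrite -v1 sqr_coord_le_sqnorm.
  rewrite (_ : S = sqnorm @^-1` [set 1])//.
  apply: preimage_closed; last exact: closed_eq.
  by move=> x _; exact: qform_continuous.
have S0 : S !=set0 by exists (delta_mx 0 (Ordinal d0)); exact: sqnorm_delta.
have [|v vS vmin] := EVT_min_rV S0 cS (f := qform M).
  exact/continuous_subspaceT/qform_continuous.
move/set_mem: vS; rewrite /S/= => v1.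
have qmin u : qform M v * sqnorm u <= qform M u.
  have [->|] := eqVneq u 0.
    by rewrite -(scale0r v) /sqnorm !qformZ expr0n mul0r mulr0 mul0r.
  rewrite -sqnorm_gt0 => u0; rewrite -ler_pdivlMr//.
  have : qform M v <= qform M ((Num.sqrt (sqnorm u))^-1 *: u).
    apply: vmin; rewrite inE /S/= {1}/sqnorm qformZ -/(sqnorm u) exprVn.
    by rewrite sqr_sqrtr ?sqnorm_ge0// mulVf// gt_eqF.
  by rewrite qformZ exprVn sqr_sqrtr ?sqnorm_ge0// mulrC.
have vne0 : v != 0 by rewrite -sqnorm_gt0 v1.
exists v => //; split => //; apply/eqP; rewrite eq_le; apply/andP.
(* Minimality makes this shift positive semidefinite, and [v] is isotropic for it, hence an
   eigenvector of [M]. *)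
have pN : psd (M - (qform M v)%:M).
  split; first by rewrite linearB/= tr_scalar_mx pM.1.
  by move=> u; rewrite qformB qform_scalar subr_ge0.
have ev : eigenvalue M (qform M v).
  apply/eigenvalueP; exists v => //; apply/eqP; rewrite -subr_eq0.
  rewrite -mul_mx_scalar -mulmxBr psd_isotropic//.
  by rewrite qformB qform_scalar v1 mulr1 subrr.
have lb : lbound [set l | eigenvalue M l] (qform M v).
  move=> l /= /eigenvalueP[u ul u0]; rewrite -sqnorm_gt0 in u0.
  rewrite -(ler_pM2r u0) (le_trans (qmin u))//.
  by rewrite /qform /bform ul -scalemxAl mxE /sqnorm /qform /bform mulmx1.
split; first by apply: ge_inf => //; exists (qform M v).
by apply: lb_le_inf => //; exists (qform M v).
Qed.

Lemma lambda_min_geP M t : (0 < d)%N -> psd M ->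
  (t <= lambda_min M <-> forall v, t * sqnorm v <= qform M v).
Proof.
move=> d0 pM; have [v v1 [-> vmin]] := lambda_min_attained d0 pM; split.
  by move=> tv u; apply: le_trans (vmin u); rewrite ler_wpM2r// sqnorm_ge0.
by move=> /(_ v); rewrite v1 mulr1.
Qed.

End bilinear_form.

(** * Convex hulls *)

(** Fixing the number of terms makes this the continuous image of a compact set when [S] is
    compact. *)
Definition conv_comb (R : realType) (V : lmodType R) (n : nat) (S : set V) : set V :=
  [set M | exists w x, [/\ forall i : 'I_n, 0 <= w i, \sum_i w i = 1,
     forall i, S (x i) & M = \sum_i w i *: x i]].

Definition hull (R : realType) (V : lmodType R) (S : set V) : set V :=
  [set M | exists n, conv_comb n S M].

Section convex_hull.
Context {R : realType} {p q : nat}.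
Implicit Types (S : set 'M[R]_(p, q)) (M : 'M[R]_(p, q)).

Lemma conv_comb_pad n S M : conv_comb n S M -> conv_comb n.+1 S M.
Proof.
case: n => [|n] [w [x [w0 w1 Sx ->]]].
  by move: w1; rewrite big_ord0 => /eqP; rewrite eq_sym oner_eq0.
exists (fun i => oapp w 0 (unlift ord0 i)), (fun i => oapp x (x 0) (unlift ord0 i)).
split => [i||i|]; first by case: unliftP => [j _|_] /=.
- by rewrite big_ord_recl unlift_none add0r -w1; apply: eq_bigr => i _; rewrite liftK.
- by case: unliftP => [j _|_] /=.
rewrite [in RHS]big_ord_recl unlift_none scale0r add0r.
by apply: eq_bigr => i _; rewrite liftK.
Qed.

(** Flattened and extended by an entry 1, the points are rows of length [p * q + 1], so that this
    many of them are linearly dependent. The extra column makes the coefficients sum to 0. *)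
Lemma affine_dependence n (x : 'I_n -> 'M[R]_(p, q)) : ((p * q).+1 < n)%N ->
  exists u : 'I_n -> R,
    [/\ exists i, 0 < u i, \sum_i u i = 0 & \sum_i u i *: x i = 0].
Proof.
move=> pqn; pose X : 'M[R]_(n, p * q) := \matrix_i mxvec (x i).
pose Y := row_mx X (const_mx 1 : 'cV[R]_n).
have : kermx Y != 0.
  rewrite kermx_eq0 /row_free neq_ltn (leq_ltn_trans (rank_leq_col Y))//.
  by rewrite addn1.
move=> /rowV0Pn[u /sub_kermxP]; rewrite mul_mx_row -[RHS]row_mx0.
move=> /eq_row_mx[uX u1] u0; have su : \sum_i u 0 i = 0.
  have /matrixP/(_ 0 0) := u1; rewrite !mxE => {2}<-.
  by apply: eq_bigr => i _; rewrite mxE mulr1.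
exists (u 0); split => //; last first.
  rewrite mulmx_sum_row in uX; apply: (can_inj (@mxvecK _ _ _)).
  rewrite linear_sum/= linear0 -[RHS]uX; apply: eq_bigr => i _.
  by rewrite linearZ/= rowK.
(* Coefficients that sum to 0 with none positive would all vanish. *)
apply: contrapT => /forallNP uN; case/negP: u0; apply/eqP/rowP => i.
rewrite mxE; apply/eqP; rewrite -oppr_eq0; apply/eqP; move: i (isT).
apply: psumr_eq0P; last by rewrite sumrN su oppr0.
by move=> i _; rewrite oppr_ge0 leNgt; apply/negP/uN.
Qed.

(** Moving the weights along an affine dependence changes neither their sum nor the point. The
    smallest ratio [w i / u i] over positive [u i] is the step at which a first weight reaches 0
    while all stay nonnegative. *)
Lemma conv_comb_drop n S M : ((p * q).+1 < n.+1)%N ->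
  conv_comb n.+1 S M -> conv_comb n S M.
Proof.
move=> pqn [w [x [w0 w1 Sx ->]]].
have [u [[i1 ui1] u0 ux0]] := affine_dependence x pqn.
have [i0 ui0 mini0] : exists2 i0, 0 < u i0 &
    forall i, 0 < u i -> w i0 / u i0 <= w i / u i.
  case: (@arg_minP _ _ _ i1 (fun i => 0 < u i) (fun i => w i / u i) ui1) => i0.
  by exists i0.
set t := w i0 / u i0; pose w' i := w i - t * u i.
have t0 : 0 <= t by rewrite divr_ge0// ltW.
have w'0 : w' i0 = 0 by rewrite /w' divfK ?subrr// gt_eqF.
exists (fun j => w' (lift i0 j)), (fun j => x (lift i0 j)); split => // [j||].
- rewrite subr_ge0; have [uj|uj] := ltP 0 (u (lift i0 j)).
    by rewrite -ler_pdivlMr// mini0.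
  by rewrite (le_trans _ (w0 _))// mulr_ge0_le0.
- have : \sum_i w' i = 1 by rewrite sumrB -mulr_sumr u0 mulr0 subr0.
  by rewrite (bigD1_ord i0)//= w'0 add0r.
- have : \sum_i w' i *: x i = \sum_i w i *: x i.
    under eq_bigr do rewrite scalerBl -scalerA.
    by rewrite sumrB -scaler_sumr ux0 scaler0 subr0.
  by rewrite (bigD1_ord i0)//= w'0 scale0r add0r.
Qed.

Lemma caratheodory S : hull S = conv_comb (p * q).+1 S.
Proof.
apply/seteqP; split => M; last by exists (p * q).+1.
move=> [n]; have [np|pn] := leqP n (p * q).+1.
  rewrite -(subnK np); elim: (_ - n)%N => // k ih /ih.
  exact: conv_comb_pad.
rewrite -(subnK (ltnW pn)); elim: (_ - _)%N => // k ih SM; apply: ih.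
by apply: conv_comb_drop => //; rewrite ltnS leq_addl.
Qed.

Lemma compact_conv_comb n S : compact S -> compact (conv_comb n S).
Proof.
move=> cS; pose X := prod_topology (fun _ : 'I_n => R * 'M[R]_(p, q))%type.
pose g (f : X) : 'M[R]_(p, q) := \sum_i (f i).1 *: (f i).2.
pose s (f : X) : R := \sum_i (f i).1.
have cproj i : continuous (fun f : X => f i) by exact: proj_continuous.
have cproj1 i : continuous (fun f : X => (f i).1).
  by move=> f; apply: continuous_comp; [exact: cproj|exact: cvg_fst].
have cproj2 i : continuous (fun f : X => (f i).2).
  by move=> f; apply: continuous_comp; [exact: cproj|exact: cvg_snd].
have cg : continuous g.
  by apply: continuous_sum => i f; exact: cvgZ (cproj1 i f) (cproj2 i f).
have cs : continuous s by apply: continuous_sum.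
(* Weights and points are chosen jointly: [P] is a closed part of a product of compact sets, by
   Tychonoff. *)
pose P : set X := [set f | forall i, (`[0, 1] `*` S) (f i)] `&` s @^-1` [set 1].
rewrite (_ : conv_comb n S = g @` P).
  apply: continuous_compact; first exact: continuous_subspaceT.
  apply: compact_closedI.
    apply: (@tychonoff _ (fun _ : 'I_n => R * 'M[R]_(p, q))%type
      (fun _ => `[0, 1] `*` S)).
    by move=> i; apply: compact_setX => //; exact: segment_compact.
  by apply: preimage_closed; [move=> f _; exact: cs|exact: closed_eq].
apply/seteqP; split => [_ [w [x [w0 w1 Sx ->]]]|_ [f [fP f1] <-]].
  exists (fun i => (w i, x i)) => //; split => // i; split => //=.
  rewrite in_itv/= w0 -w1 (bigD1 i)//= lerDl.
  by rewrite sumr_ge0// => j _; exact: w0.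
exists (fun i => (f i).1), (fun i => (f i).2); split => // i.
  by have [] := fP i; rewrite /= in_itv/= => /andP[].
by have [] := fP i.
Qed.

Lemma compact_hull S : compact S -> compact (hull S).
Proof. by rewrite caratheodory; exact: compact_conv_comb. Qed.

End convex_hull.

Lemma hull_convex (R : realType) (V : lmodType R) (S : set V) (x y : V) (t : R) :
  0 <= t <= 1 -> hull S x -> hull S y -> hull S (t *: x + (1 - t) *: y).
Proof.
move=> /andP[t0 t1] [m [w [a [w0 w1 Sa ->]]]] [n [v [b [v0 v1 Sb ->]]]].
exists (m + n)%N,
  (fun i => match fintype.split i with
            | inl j => t * w j
            | inr j => (1 - t) * v j
            end),
  (fun i => match fintype.split i with inl j => a j | inr j => b j end).
have sl j : fintype.split (lshift n j : 'I_(m + n)) = inl j.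
  exact: (unsplitK (inl j)).
have sr j : fintype.split (rshift m j : 'I_(m + n)) = inr j.
  exact: (unsplitK (inr j)).
split => [i||i|].
- by case: (fintype.split i) => j; rewrite mulr_ge0// subr_ge0.
- rewrite big_split_ord/=; under eq_bigr do rewrite sl.
  under [X in _ + X]eq_bigr do rewrite sr.
  by rewrite -!mulr_sumr w1 v1; ring.
- by case: (fintype.split i).
- rewrite big_split_ord/=; under [in RHS]eq_bigr do rewrite sl -scalerA.
  under [X in _ = _ + X]eq_bigr do rewrite sr -scalerA.
  by rewrite -!scaler_sumr.
Qed.

(** * Projection on a convex hull for the Frobenius inner product *)

Section frobenius.
Context {R : realType} {p q : nat}.
Implicit Types M N : 'M[R]_(p, q).

Definition mxdot M N : R := \sum_(ij : 'I_p * 'I_q) M ij.1 ij.2 * N ij.1 ij.2.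

Lemma mxdotDr M N N' : mxdot M (N + N') = mxdot M N + mxdot M N'.
Proof. by rewrite -big_split; apply: eq_bigr => ij _; rewrite mxE mulrDr. Qed.

Lemma mxdotZr t M N : mxdot M (t *: N) = t * mxdot M N.
Proof. by rewrite mulr_sumr; apply: eq_bigr => ij _; rewrite mxE mulrCA. Qed.

Lemma mxdotC M N : mxdot M N = mxdot N M.
Proof. by apply: eq_bigr => ij _; rewrite mulrC. Qed.

Lemma mxdot_ge0 M : 0 <= mxdot M M.
Proof. by apply: sumr_ge0 => ij _; rewrite -expr2 sqr_ge0. Qed.

Lemma mxdot_eq0 M : mxdot M M = 0 -> M = 0.
Proof.
move=> M0; apply/matrixP => i j; rewrite mxE; apply/eqP; rewrite -sqrf_eq0.
apply/eqP; rewrite expr2; apply: (psumr_eq0P _ M0 (i := (i, j))) => // ij _.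
by rewrite -expr2 sqr_ge0.
Qed.

Lemma mxdot_sqrB t M N : mxdot (M - t *: N) (M - t *: N) =
  mxdot M M - 2 * t * mxdot M N + t ^+ 2 * mxdot N N.
Proof.
rewrite -scaleNr mxdotDr mxdotZr ![mxdot (_ + _) _]mxdotC !mxdotDr !mxdotZr.
by rewrite (mxdotC N M); ring.
Qed.

(** [P] is a point of the hull nearest to [Q]; moving from it towards [N] cannot decrease the
    distance. *)
Lemma hull_projection (S : set 'M[R]_(p, q)) (Q : 'M[R]_(p, q)) : compact S -> S !=set0 ->
  exists2 P, hull S P & forall N, S N -> mxdot (Q - P) N <= mxdot (Q - P) P.
Proof.
move=> cS [N0 SN0].
have subhull N : S N -> hull S N.
  move=> SN; exists 1, (fun=> 1), (fun=> N).
  by split => //; rewrite big_ord1 ?scale1r.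
have [||P] := compact_EVT_min (f := fun P : 'M[R]_(p, q) => mxdot (Q - P) (Q - P)) _
  (compact_hull cS).
- by exists N0; exact: subhull.
- apply/continuous_subspaceT/continuous_sum => ij.
  rewrite (_ : (fun P => _) = fun P : 'M[R]_(p, q) =>
    (Q ij.1 ij.2 - P ij.1 ij.2) * (Q ij.1 ij.2 - P ij.1 ij.2)); last first.
    by apply/funext => P; rewrite !mxE.
  have cB : continuous (fun P : 'M[R]_(p, q) => Q ij.1 ij.2 - P ij.1 ij.2).
    by move=> P; exact: cvgB (cvg_cst _) (@coord_continuous R p q ij.1 ij.2 P).
  exact: continuous_mul.
move=> /set_mem KP Pmin; exists P => // N SN.
set D := Q - P; pose E := N - P; set e := mxdot D E.
have ineq t : 0 < t -> t <= 1 -> 2 * e <= t * mxdot E E.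
  move=> t0 t1; have : mxdot D D <= mxdot (D - t *: E) (D - t *: E).
    have -> : D - t *: E = Q - (t *: N + (1 - t) *: P).
      by apply/matrixP => i j; rewrite !mxE; ring.
    apply: Pmin; rewrite inE; apply: hull_convex => //; last exact: subhull.
    by rewrite (ltW t0).
  rewrite mxdot_sqrB -/e.
  move=> h; have h2 : t * (2 * e) <= t * (t * mxdot E E) by lra.
  by rewrite ler_pM2l in h2.
suff : e <= 0 by rewrite /e /E mxdotDr -scaleN1r mxdotZr; lra.
have [//|e0] := leP e 0.
have h1 := ineq 1 ltr01 (lexx 1).
move: ineq h1 (mxdot_ge0 E); move: (mxdot E E) => s ineq h1 s0.
have s_gt0 : 0 < s by lra.
(* One small step replaces the limit at 0: at [t = e / s], at most 1 by [h1], the inequality becomes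
   [2 * e <= e]. *)
have := ineq (e / s) (divr_gt0 e0 s_gt0).
rewrite ler_pdivrMr// mul1r divfK ?gt_eqF// => h; have := h _; lra.
Qed.

End frobenius.

(** * Second moment matrices *)

Section discrete_probability.
Context d (T : measurableType d) (R : realType) (n : nat).
Context (w : 'I_n -> R) (x : 'I_n -> T) (w0 : forall i, 0 <= w i).

(** [msum] sums a sequence of measures indexed by [nat], so the weighted Dirac masses are continued
    by zero. *)
Let m_ (k : nat) : {measure set T -> \bar R} :=
  if insub k is Some i then mscale (NngNum (w0 i)) (dirac (x i)) else mzero.

Let m_ord (i : 'I_n) : m_ i = mscale (NngNum (w0 i)) (dirac (x i)).
Proof. by rewrite /m_ valK. Qed.

Lemma discrete_probability : \sum_i w i = 1 ->
  exists P : probability T R, forall (D : set T) (f : T -> R), measurable D ->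
    (forall i, D (x i)) -> measurable_fun D f ->
    P D = 1%E /\ \int[P]_(t in D) f t = \sum_i w i * f (x i).
Proof.
move=> w1; pose nu : {measure set T -> \bar R} := msum m_ n.
have mD1 D : (forall i, D (x i)) -> nu D = 1%E.
  move=> Dx; rewrite /nu/= /msum (eq_bigr (fun i => (w i)%:E)) ?sumEFin ?w1// => i _.
  rewrite m_ord -[LHS]/((w i)%:E * \d_(x i) D)%E diracE mem_set//.
  by rewrite mule1.
(* Normalizing only supplies the type of probabilities: the total mass is already 1. *)
have mn U : mnormalize nu point U = nu U.
  by rewrite /mnormalize (mD1 setT)// onee_eq0/= invr1 mule1.
exists (mnormalize nu point) => D f mD Dx mf; split.
  by rewrite -(mD1 _ Dx) -mn.
have int_ge0 (g : T -> R) : measurable_fun D g -> (forall t, 0 <= g t) ->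
    (\int[mnormalize nu point]_(t in D) (g t)%:E =
     (\sum_i w i * g (x i))%:E)%E.
  move=> mg g0; rewrite (@eq_measure_integral _ _ _ _ nu); last first.
    by move=> U _ _; exact: mn.
  have mEg : measurable_fun D (EFin \o g) by exact/measurable_EFinP.
  rewrite ge0_integral_measure_sum//; last by move=> t _; rewrite lee_fin.
  rewrite -sumEFin; apply: eq_bigr => i _; rewrite m_ord.
  rewrite ge0_integral_mscale//; last by move=> t _; rewrite lee_fin.
  by rewrite integral_dirac// diracE mem_set// mul1e.
(* Integration against a sum of measures was done for nonnegative functions; [f] is split
   accordingly. *)
rewrite /Rintegral integralE (funerpos f) (funerneg f).
rewrite (int_ge0 f^\+); [|exact: measurable_funrpos|exact: funrpos_ge0].
rewrite (int_ge0 f^\-); [|exact: measurable_funrneg|exact: funrneg_ge0].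
rewrite -EFinB/= -sumrB; apply: eq_bigr => i _.
by rewrite -mulrBr -[in RHS](funrposBneg f).
Qed.

End discrete_probability.

Lemma Rintegral_sum d (T : measurableType d) (R : realType)
    (mu : {measure set T -> \bar R}) (D : set T) (I : Type) (s : seq I)
    (f : I -> T -> R) : measurable D ->
  (forall i, mu.-integrable D (EFin \o f i)) ->
  \int[mu]_(x in D) (\sum_(i <- s) f i x) = \sum_(i <- s) \int[mu]_(x in D) f i x.
Proof.
move=> mD intf; rewrite /Rintegral.
under eq_integral do rewrite -sumEFin.
rewrite integral_sum// -sum_fine// => i _.
exact: (integrable_fin_num mD (intf i)).
Qed.

Section second_moments.
Context {R : realType} {d : nat}.
Implicit Types (A : set 'cV[R]_d) (a : 'cV[R]_d).

Definition rank1 a : 'M[R]_d := a *m a^T.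

Lemma rank1E a i j : rank1 a i j = a i 0 * a j 0.
Proof. by rewrite mxE big_ord1 !mxE. Qed.

Lemma borelRd_measurable_compact A : compact A -> measurable (A : set (borelRd R d)).
Proof.
move=> cA; rewrite -(setCK A); apply: measurableC.
apply: sub_sigma_algebra; apply: closed_openC.
exact: compact_closed (@norm_hausdorff _ _) cA.
Qed.

Lemma borelRd_measurable_fun A (f : 'cV[R]_d -> R) : compact A -> continuous f ->
  measurable_fun (A : set (borelRd R d)) (f : borelRd R d -> R).
Proof.
move=> cA /continuousP cf mA; apply: (measurability _ (RGenOpens.measurableE R)) => //.
move=> _ [_ [a [b ->] <-]]; apply: measurableI => //.
by apply: sub_sigma_algebra; apply: cf; exact: interval_open.
Qed.

Lemma rank1_coord_continuous i j : continuous (fun a => rank1 a i j).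
Proof.
rewrite (_ : (fun a => _) = fun a => a i 0 * a j 0).
  by apply: continuous_mul; exact: coord_continuous.
by apply/funext => a; rewrite rank1E.
Qed.

Lemma rank1_continuous : continuous rank1.
Proof.
move=> a U [P aP PU].
have aPij (ij : 'I_d * 'I_d) : nbhs a [set b | P ij.1 ij.2 (rank1 b ij.1 ij.2)].
  exact: (@rank1_coord_continuous ij.1 ij.2 a _ (aP ij.1 ij.2)).
suff : nbhs a (rank1 @^-1` U) by [].
have aP' := filter_forall (nbhs_filter a) aPij.
apply: filterS aP' => b Pb.
by apply: PU => i j; exact: (Pb (i, j)).
Qed.

Lemma rank1_integrable A (mu : probability (borelRd R d) R) i j :
  compact A -> A `<=` cube R d ->
  mu.-integrable (A : set (borelRd R d)) (EFin \o (fun a => rank1 a i j)).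
Proof.
move=> cA A1; apply: measurable_bounded_integrable.
- exact: borelRd_measurable_compact.
- rewrite (le_lt_trans (probability_le1 _ _)) ?ltry//.
  exact: borelRd_measurable_compact.
- exact: borelRd_measurable_fun (@rank1_coord_continuous i j).
exists 1; split; first exact: num_real.
move=> M M1 a Aa; rewrite /= rank1E normrM (le_trans _ (ltW M1))//.
by rewrite mulr_ile1// ler_norml; exact: A1.
Qed.

(** This replaces measures by a compact convex set of matrices in all that follows. *)
Lemma Qmx_image A : compact A -> A `<=` cube R d ->
  [set Qmx A mu | mu in prob_on A] = hull (rank1 @` A).
Proof.
move=> cA A1; have mA := borelRd_measurable_compact cA.
apply/seteqP; split => [_ [mu muA <-]|M [n [w [y [w0 w1 Sy ->]]]]]; last first.
  have /choice[a ay] : forall i, exists a, A a /\ rank1 a = y i.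
    by move=> i; have [a] := Sy i; exists a.
  have [P PE] := @discrete_probability _ (borelRd R d) R n w a w0 w1.
  exists P.
    by have [|PA _] := PE A (cst 0) mA (fun i => (ay i).1).
  apply/matrixP => i j; rewrite mxE summxE.
  have [|_] := PE A (fun a => rank1 a i j) mA (fun i => (ay i).1).
    exact: borelRd_measurable_fun (@rank1_coord_continuous i j).
  by move=> ->; apply: eq_bigr => k _; rewrite -(ay k).2 [in RHS]mxE.
have {}muA : mu A = 1%E := muA; have A0 : A !=set0.
  apply/set0P/eqP => A0; move: muA; rewrite A0 measure0 => /eqP.
  by rewrite eq_sym onee_eq0.
set Q := Qmx A mu.
have S0 : rank1 @` A !=set0 by have [a Aa] := A0; exists (rank1 a), a.
have cS : compact (rank1 @` A).
  apply: continuous_compact => //; apply: continuous_subspaceT.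
  exact: rank1_continuous.
have [P KP Pproj] := hull_projection Q cS S0.
(* This says that the squared norm of [Q - P] is at most 0. *)
suff QP : mxdot (Q - P) Q <= mxdot (Q - P) P.
  suff : Q - P = 0 by move=> /eqP; rewrite subr_eq0 => /eqP ->.
  apply/mxdot_eq0/eqP; rewrite eq_le mxdot_ge0 andbT.
  by rewrite [in leLHS]mxdotDr -[X in _ + mxdot _ X]scaleN1r mxdotZr mulN1r subr_le0.
pose f (ij : 'I_d * 'I_d) a := (Q - P) ij.1 ij.2 * rank1 a ij.1 ij.2.
have intf ij : mu.-integrable (A : set (borelRd R d)) (EFin \o f ij).
  rewrite (_ : EFin \o _ = (fun a =>
    ((Q - P) ij.1 ij.2)%:E * (rank1 a ij.1 ij.2)%:E)%E)//.
  by apply: integrableZl => //; exact: rank1_integrable.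
(* Both sides become integrals over [A], the right one of a constant since [mu A = 1]; the
   integrands are then compared by the projection inequality at [rank1 a]. *)
have -> : mxdot (Q - P) Q = \int[mu]_(a in A) (\sum_ij f ij a).
  rewrite Rintegral_sum//; apply: eq_bigr => ij _.
  rewrite RintegralZl//; last exact: rank1_integrable.
  by congr (_ * _); rewrite mxE.
have -> : mxdot (Q - P) P = \int[mu]_(a in A) (mxdot (Q - P) P).
  by rewrite Rintegral_cst// (_ : fine _ = 1) ?mulr1//; exact: (congr1 fine muA).
apply: le_Rintegral => //.
- rewrite (_ : EFin \o _ = (fun a => \sum_ij (f ij a)%:E)%E).
    by apply: integrable_sum => // ij _; exact: intf.
  by apply/funext => a; rewrite /= sumEFin.
- apply: measurable_bounded_integrable => //.
    exact: (eq_ind_r (fun x => x < +oo)%E (ltry 1) muA).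
  by exists `|mxdot (Q - P) P|; split => // M /ltW ? a _.
by move=> a Aa; apply: Pproj; exists a.
Qed.

End second_moments.

(** * Optimal designs *)

Section hull_bounds.
Context {R : realType} {V : lmodType R}.
Implicit Types (S : set V) (f : V -> R).

Lemma scalar_sum f (I : finType) (w : I -> R) (x : I -> V) : scalar f ->
  f (\sum_i w i *: x i) = \sum_i w i * f (x i).
Proof.
move=> fl; have f0 : f 0 = 0.
  by have := fl (-1) 0 0; rewrite scaler0 addr0 mulN1r addNr.
apply: (big_rec2 (fun M s => f M = s)) => // i s M _ <-; exact: fl.
Qed.

Lemma hull_le S f c : scalar f -> (forall x, S x -> f x <= c) ->
  forall x, hull S x -> f x <= c.
Proof.
move=> fl Sc _ [n [w [x [w0 w1 Sx ->]]]]; rewrite scalar_sum//.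
rewrite -[leRHS]mul1r -w1 mulr_suml; apply: ler_sum => i _.
by rewrite ler_wpM2l ?w0//; exact: Sc.
Qed.

Lemma hull_fin S (I : finType) (w : I -> R) (x : I -> V) :
  (forall i, 0 <= w i) -> \sum_i w i = 1 -> (forall i, S (x i)) ->
  hull S (\sum_i w i *: x i).
Proof.
move=> w0 w1 Sx; exists #|I|, (w \o enum_val), (x \o enum_val); split => //=.
- by rewrite -w1 [RHS](reindex _ (onW_bij _ (@enum_val_bij I))).
- by rewrite [LHS](reindex _ (onW_bij _ (@enum_val_bij I))).
Qed.

End hull_bounds.

Section design.
Context {R : realType} {d : nat}.
Implicit Types (A : set 'cV[R]_d) (M : 'M[R]_d) (v : 'rV[R]_d) (t : R).

Lemma qform_scalar_map v : scalar (qform^~ v).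
Proof.
move=> t M N; rewrite /qform /bform mulmxDr mulmxDl -scalemxAr -scalemxAl.
by rewrite !mxE.
Qed.

Lemma mulmx_delta_col v i : (v *m (delta_mx i 0 : 'cV_d)) 0 0 = v 0 i.
Proof. by rewrite -colE mxE. Qed.

Lemma qform_rank1 v a : qform (rank1 a) v = (v *m a) 0 0 ^+ 2.
Proof.
rewrite /qform /bform /rank1 mulmxA -mulmxA -trmx_mul [LHS]mxE big_ord1.
by rewrite [X in _ * X]mxE expr2.
Qed.

Lemma psd_hull A M : hull (rank1 @` A) M -> psd M.
Proof.
move=> [n [w [x [w0 w1 Sx ->]]]]; split => [|v].
  rewrite linear_sum/=; apply: eq_bigr => i _; rewrite linearZ/=.
  by have [a _ <-] := Sx i; rewrite /rank1 trmx_mul trmxK.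
rewrite (scalar_sum _ _ (qform_scalar_map v)); apply: sumr_ge0 => i _.
by have [a _ <-] := Sx i; rewrite mulr_ge0// qform_rank1 sqr_ge0.
Qed.

(** Take the uniform average over a finite list of arms that spans the space: a vector on which the
    form vanishes is orthogonal to every listed arm, hence zero. *)
Lemma spanning_pos_def A : (0 < d)%N -> spanning A ->
  exists2 M, hull (rank1 @` A) M & forall v, v != 0 -> 0 < qform M v.
Proof.
move=> d0 spA; have /choice[s sP] : forall i : 'I_d, exists s : seq 'cV[R]_d,
    (forall a, a \in s -> A a) /\ delta_mx i 0 \in span s.
  by move=> i; have [s] := spA (delta_mx i 0); exists s.
pose l := flatten [seq s i | i <- enum 'I_d].
have lP a : reflect (exists i, a \in s i) (a \in l).
  apply: (iffP flatten_mapP) => [[i _ ai]|[i ai]]; exists i => //.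
  by rewrite mem_enum.
have l0 v : (forall a, a \in l -> (v *m a) 0 0 = 0) -> v = 0.
  move=> vl; apply/rowP => i; rewrite [RHS]mxE.
  have -> : v 0 i = (v *m (delta_mx i 0 : 'cV_d)) 0 0 by rewrite mulmx_delta_col.
  rewrite (coord_span (X := in_tuple (s i)) (sP i).2) mulmx_sumr summxE big1// => k _.
  rewrite -scalemxAr mxE vl ?mulr0//; apply/lP; exists i.
  by apply: mem_nth; exact: ltn_ord.
(* An empty list would make every vector zero by [l0], basis vectors included. *)
have size_l : (0 < size l)%N.
  rewrite lt0n; apply/eqP => /size0nil l_nil.
  have := sqnorm_delta (R := R) (Ordinal d0).
  rewrite (l0 (delta_mx 0 (Ordinal d0))) ?l_nil//.
  rewrite -(scale0r 0) /sqnorm qformZ expr0n mul0r => /eqP.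
  by rewrite eq_sym oner_eq0.
pose w := (size l)%:R^-1 : R.
have w_gt0 : 0 < w by rewrite invr_gt0 ltr0n.
pose M := \sum_(k < size l) w *: rank1 l`_k.
have Al k : (k < size l)%N -> A l`_k.
  by move=> kl; have /lP[i] := mem_nth 0 kl; exact: (sP i).1.
have KM : hull (rank1 @` A) M.
  apply: hull_fin => [_||k]; first exact: ltW.
    by rewrite sumr_const card_ord -mulr_natr mulVf// pnatr_eq0 -lt0n.
  by exists l`_k => //; exact: Al.
exists M => // v; rewrite lt_def (psd_hull KM).2 andbT; apply: contra_neq => Mv0.
apply: l0 => a al; apply/eqP; rewrite -sqrf_eq0.
have al' : (index a l < size l)%N by rewrite index_mem.
move: Mv0; rewrite (scalar_sum _ _ (qform_scalar_map v)) => Mv0.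
have : w * qform (rank1 l`_(index a l)) v = 0.
  apply: (psumr_eq0P _ Mv0 (i := Ordinal al')) => // k _.
  by rewrite mulr_ge0 ?(ltW w_gt0)// qform_rank1 sqr_ge0.
by move=> /eqP; rewrite mulf_eq0 gt_eqF//= qform_rank1 nth_index.
Qed.

(** Sublevel sets of both objectives have this shape, with one continuous constraint per test
    vector. *)
Lemma closed_forall_le (X : topologicalType) (I : Type) (K : set X) (c : I -> R)
    (g : I -> X -> R) : closed K -> (forall i, continuous (g i)) ->
  closed [set x | K x /\ forall i, c i <= g i x].
Proof.
move=> cK cg.
rewrite (_ : [set x | _] = K `&` \bigcap_(i in setT) (g i @^-1` [set y | c i <= y])).
  apply: closedI => //; apply: closed_bigI => i _.
  by apply: preimage_closed; [move=> x _; exact: cg|exact: closed_ge].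
apply/seteqP; split => x [Kx h]; split => // i; last exact: h.
by move=> _; exact: h.
Qed.

(** * The two optima of an arm set *)

Section arm_set.
Context (A : set 'cV[R]_d) (d0 : (0 < d)%N) (armA : arm_set A).
Let K := hull (rank1 @` A).

Let compactK : compact K.
Proof.
have [cA _ _] := armA; apply: compact_hull; apply: continuous_compact => //.
by apply: continuous_subspaceT; exact: rank1_continuous.
Qed.

Let closedK : closed K.
Proof. exact: compact_closed (@norm_hausdorff _ _) compactK. Qed.

Let K_neq0 : K !=set0.
Proof.
by have [_ _ /(spanning_pos_def d0)[M KM _]] := armA; exists M.
Qed.

Lemma C_valuesE : C_values A = [set (lambda_min M)%:E | M in K].
Proof. by have [cA A1 _] := armA; rewrite /K -Qmx_image// image_comp. Qed.

Lemma H_valuesE : H_values A = [set max_diag_inv M | M in K].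
Proof. by have [cA A1 _] := armA; rewrite /K -Qmx_image// image_comp. Qed.

(** An optimal design and a bound on all designs, both in terms of quadratic forms: later arguments
    need neither eigenvalues nor measures. *)
Lemma CminP : exists2 c : R, 0 < c & [/\ Cmin A = c%:E, C_values A (Cmin A),
  exists2 M, K M & forall v, c * sqnorm v <= qform M v &
  forall M t, K M -> (forall v, t * sqnorm v <= qform M v) -> t <= c].
Proof.
have [||M KM Mmax] := compact_closed_sublevel_min
    (f := fun M => (- lambda_min M)%:E) compactK.
- exact: K_neq0.
- move=> t; rewrite (_ : [set M | _] =
    [set M | K M /\ forall v, - t * sqnorm v <= qform M v]).
    exact: (closed_forall_le (g := fun v M => qform M v) closedK qform_continuousl).
  apply/seteqP; split => M [KM h]; split => //.
    by apply/(lambda_min_geP _ d0 (psd_hull KM)); rewrite lerNl -lee_fin.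
  by move/(lambda_min_geP _ d0 (psd_hull KM)): h; rewrite lerNl lee_fin.
have MP t N : K N -> (forall v, t * sqnorm v <= qform N v) -> t <= lambda_min M.
  move=> KN /(lambda_min_geP _ d0 (psd_hull KN)) /le_trans; apply.
  by have := Mmax _ KN; rewrite lee_fin lerN2.
have CE : Cmin A = (lambda_min M)%:E.
  apply/eqP; rewrite eq_le; apply/andP; split.
    apply: ge_ereal_sup; rewrite C_valuesE => _ [N KN <-].
    by have := Mmax _ KN; rewrite !lee_fin lerN2.
  by apply: ereal_sup_ubound; rewrite C_valuesE; exists M.
exists (lambda_min M).
  (* The optimum is positive because some design is positive definite. *)
  have [_ _ /(spanning_pos_def d0)[N KN N0]] := armA.
  have [v v1 [vE vmin]] := lambda_min_attained d0 (psd_hull KN).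
  by rewrite (lt_le_trans _ (MP _ _ KN vmin))// N0// -sqnorm_gt0 v1.
split => //; first by rewrite CE C_valuesE; exists M.
  by exists M => //; apply/(lambda_min_geP _ d0 (psd_hull KM)).
by move=> N t; exact: MP.
Qed.

Lemma Hstar2P : exists h : R, [/\ Hstar2 A = h%:E, H_values A (Hstar2 A),
  exists2 M, K M & forall i v, v 0 i ^+ 2 <= h * qform M v &
  forall M t, K M -> (forall i v, v 0 i ^+ 2 <= t * qform M v) -> h <= t].
Proof.
have [||M KM Mmin] := compact_closed_sublevel_min (f := @max_diag_inv R d) compactK.
- exact: K_neq0.
- move=> t; rewrite (_ : [set M | _] =
    [set M | K M /\ forall iv : 'I_d * 'rV[R]_d, iv.2 0 iv.1 ^+ 2 <= t * qform M iv.2]).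
    apply: (closed_forall_le (g := fun (iv : 'I_d * 'rV[R]_d) M => t * qform M iv.2)
      closedK) => iv.
    by apply: continuous_mul; [exact: cst_continuous|exact: qform_continuousl].
  apply/seteqP; split => M [KM h]; split => //.
    by move=> [i v]; move/(max_diag_inv_leP _ d0 (psd_hull KM)): h; exact.
  by apply/(max_diag_inv_leP _ d0 (psd_hull KM)) => i v; exact: (h (i, v)).
have MP t N : K N -> (forall i v, v 0 i ^+ 2 <= t * qform N v) ->
    (max_diag_inv M <= t%:E)%E.
  move=> KN /(max_diag_inv_leP _ d0 (psd_hull KN)); apply: le_trans.
  exact: Mmin.
have HE : Hstar2 A = max_diag_inv M.
  apply/eqP; rewrite eq_le; apply/andP; split.
    by apply: ereal_inf_lbound; rewrite H_valuesE; exists M.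
  by apply: le_ereal_inf_tmp; rewrite H_valuesE => _ [N KN <-]; exact: Mmin.
have [c c0 [_ _ [N KN NP] _]] := CminP.
(* The design optimal for [Cmin] shows that the optimum is not [+oo]; it is not [-oo] either, as a
   maximum over a nonempty index set. *)
have Mc : (max_diag_inv M <= (c^-1)%:E)%E.
  apply: MP KN _ => i v; rewrite ler_pdivlMl// (le_trans _ (NP v))//.
  by rewrite ler_pM2l// sqr_coord_le_sqnorm.
have [h hE] : exists h : R, max_diag_inv M = h%:E.
  move: Mc; rewrite /max_diag_inv; case: ifP => [_|_]; last by rewrite leye_eq.
  have := le_bigmax (-oo%E : \bar R) (fun i => (invmx M i i)%:E) (Ordinal d0).
  by case: (\big[_/_]_(i < d) _) => [h| |//] + hc; [exists h|].
exists h; split.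
- by rewrite HE.
- by rewrite HE H_valuesE; exists M.
- by exists M => //; apply/(max_diag_inv_leP _ d0 (psd_hull KM)); rewrite hE.
- by move=> N' t KN' /(MP _ _ KN'); rewrite hE lee_fin.
Qed.

End arm_set.

End design.

(** Each inequality tests the optimal design of one criterion in the other criterion. *)
Lemma optimal_design_bounds (R : realType) (d : nat) (A : set 'cV[R]_d) :
  (0 < d)%N -> arm_set A ->
  [/\ H_values A (Hstar2 A), C_values A (Cmin A),
      (Hstar2 A <= (Cmin A)^-1)%E &
      ((Cmin A)^-1 <= d%:R%:E * Hstar2 A)%E].
Proof.
move=> d0 armA; have [c c0 [CE CA [M KM Mc] cmax]] := CminP d0 armA.
have [h [HE HA [N KN Nh] hmin]] := Hstar2P d0 armA.
split => //; rewrite CE HE inver gt_eqF// -?EFinM lee_fin.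
  apply: hmin KM _ => i v; rewrite ler_pdivlMl// (le_trans _ (Mc v))//.
  by rewrite ler_pM2l// sqr_coord_le_sqnorm.
have dh v : sqnorm v <= d%:R * h * qform N v.
  rewrite sqnormE -mulrA mulr_natl -[d in _ *+ d]card_ord -sumr_const.
  by apply: ler_sum => i _; exact: Nh.
have dh0 : 0 < d%:R * h.
  rewrite ltNge; apply/negP => dh0.
  have := dh (delta_mx 0 (Ordinal d0)); rewrite sqnorm_delta leNgt => /negP; apply.
  rewrite (le_lt_trans _ ltr01)// mulr_le0_ge0//; exact: (psd_hull KN).2.
rewrite -[leRHS]invrK lef_pV2 ?posrE ?invr_gt0//.
by apply: cmax KN _ => v; rewrite ler_pdivrMl.
Qed.

(** * Tightness *)

Section standard_basis.
Context {R : realType} {d : nat}.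
Implicit Types (A : set 'cV[R]_d) (M : 'M[R]_d) (v : 'rV[R]_d).

Definition basis_set : set 'cV[R]_d := range (fun i : 'I_d => delta_mx i 0).

Lemma basis_set_compact : compact basis_set.
Proof. by apply: finite_compact; apply: finite_image; exact: finite_finset. Qed.

Lemma basis_set_cube : basis_set `<=` cube R d.
Proof.
move=> _ [i _ <-] j; rewrite mxE eqxx andbT.
case: (j == i); last by rewrite lerN10 ler01.
by rewrite lexx andbT (le_trans (lerN10 _) ler01).
Qed.

Lemma spanning_basis_set A : basis_set `<=` A -> spanning A.
Proof.
move=> bA v; exists [seq delta_mx i 0 | i <- enum 'I_d].
  by move=> a /mapP[i _ ->]; apply: bA; exists i.
rewrite [v]matrix_sum_delta; apply: rpred_sum => i _; rewrite big_ord1.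
by apply: rpredZ; apply: memv_span; apply: map_f; rewrite mem_enum.
Qed.

Lemma rank1_delta_col (i : 'I_d) : rank1 (delta_mx i 0) = delta_mx i i :> 'M[R]_d.
Proof. by rewrite /rank1 trmx_delta mul_delta_mx. Qed.

Lemma hull_basis_scalar A : (0 < d)%N -> basis_set `<=` A ->
  hull (rank1 @` A) (d%:R^-1)%:M.
Proof.
move=> d0 bA.
have -> : (d%:R^-1)%:M = \sum_i d%:R^-1 *: rank1 (delta_mx i 0) :> 'M[R]_d.
  rewrite -scaler_sumr -scalemx1; congr (_ *: _).
  rewrite [LHS]matrix_sum_delta; apply: eq_bigr => i _.
  rewrite rank1_delta_col (bigD1 i)//= mxE eqxx scale1r big1 ?addr0// => j ji.
  by rewrite mxE eq_sym (negbTE ji) scale0r.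
apply: hull_fin => [_||i].
- by rewrite invr_ge0 ler0n.
- by rewrite sumr_const card_ord -[LHS]mulr_natr mulVf// pnatr_eq0 -lt0n.
- by exists (delta_mx i 0) => //; apply: bA; exists i.
Qed.

(** The dimension separates the two sides: the uniform design gives [c^-1 <= d], and every design
    has trace at most 1 with diagonal entries at least [1 / h], which gives [d <= h]. *)
Lemma basis_set_tight : (0 < d)%N ->
  arm_set basis_set /\ ((Cmin basis_set)^-1 <= 1%:E * Hstar2 basis_set)%E.
Proof.
move=> d0; have armA : arm_set basis_set.
  split; [exact: basis_set_compact|exact: basis_set_cube|].
  exact: spanning_basis_set.
split => //; have [c c0 [-> _ _ cmax]] := CminP d0 armA.
have [h [-> _ [M KM Mh] _]] := Hstar2P d0 armA.
rewrite -EFinM mul1r inver gt_eqF// lee_fin.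
have cd : d%:R^-1 <= c.
  apply: cmax (hull_basis_scalar d0 (@subset_refl _ _)) _ => v.
  by rewrite qform_scalar.
have dR : 0 < d%:R :> R by rewrite ltr0n.
rewrite (le_trans (y := d%:R))//.
  by rewrite -[leRHS]invrK lef_pV2// posrE ?invr_gt0.
have trM : \tr M <= 1.
  apply: (hull_le _ _ KM); first by move=> t N N'; rewrite linearP.
  move=> _ [_ [i _ <-] <-]; rewrite /rank1 mxtrace_mulC trmx_delta mul_delta_mx.
  by rewrite /mxtrace big_ord1 mxE eqxx.
have Mii i : 1 <= h * M i i.
  by have := Mh i (delta_mx 0 i); rewrite qform_delta mxE !eqxx expr1n.
have dh : d%:R <= h * \tr M.
  rewrite mulr_sumr -[d in d%:R]card_ord -sumr_const; apply: ler_sum => i _.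
  exact: Mii.
rewrite (le_trans dh)// ler_piMr// leNgt; apply/negP => h0.
have := Mii (Ordinal d0); rewrite leNgt => /negP; apply.
rewrite (le_lt_trans _ ltr01)// mulr_le0_ge0 ?(ltW h0)//.
by rewrite -qform_delta; exact: (psd_hull KM).2.
Qed.

End standard_basis.

(** * Permuted alternating signs, where the second inequality is tight *)

Section permuted_signs.
Context {R : realType} {d : nat}.
Implicit Types (v : 'rV[R]_d) (s : 'S_d).

(** All entries have modulus 1, yet they sum to 0 or 1 according to the parity of [d]. *)
Definition sign_col s : 'cV[R]_d := \col_i (-1) ^+ s i.

Definition sign_set : set 'cV[R]_d := basis_set `|` range sign_col.

Definition vsum v : R := \sum_i v 0 i.

Lemma sum_signs n : \sum_(i < n) (-1) ^+ i = (odd n)%:R :> R.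
Proof.
elim: n => [|n ih]; first by rewrite big_ord0.
rewrite big_ord_recr/= ih -signr_odd.
by case: (odd n); rewrite /= ?expr1 ?subrr// expr0 add0r.
Qed.

Lemma sum_sign_col s : \sum_i sign_col s i 0 = (odd d)%:R.
Proof.
rewrite -sum_signs [RHS](reindex_inj (@perm_inj _ s)).
by apply: eq_bigr => i _; rewrite mxE.
Qed.

Lemma sign_set_arm : arm_set sign_set.
Proof.
split.
- apply: finite_compact; rewrite finite_setU; split.
    by apply: finite_image; exact: finite_finset.
  by apply: finite_image; exact: finite_finset.
- move=> a [/basis_set_cube//|[s _ <-]] i; rewrite mxE -signr_odd.
  by case: (odd _); rewrite ?expr1 ?expr0 lexx ?andbT (le_trans (lerN10 _) ler01).
- by apply: spanning_basis_set; left.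
Qed.

Lemma sign_set_ones a : sign_set a -> ((const_mx 1 : 'rV[R]_d) *m a) 0 0 ^+ 2 <= 1.
Proof.
move=> aS; have -> : ((const_mx 1 : 'rV[R]_d) *m a) 0 0 = \sum_i a i 0.
  by rewrite mxE; apply: eq_bigr => i _; rewrite mxE mul1r.
case: aS => [[i _ <-]|[s _ <-]].
  rewrite (bigD1 i)//= mxE !eqxx big1 ?addr0 ?expr1n// => j /negbTE ji.
  by rewrite mxE ji.
by rewrite sum_sign_col; case: (odd d); rewrite ?expr1n// expr0n/= ler01.
Qed.

Definition sign_avg : 'M[R]_d := \sum_s #|{: 'S_d}|%:R^-1 *: rank1 (sign_col s).

Let card_perm_gt0 : 0 < #|{: 'S_d}|%:R :> R.
Proof. by rewrite ltr0n; apply/card_gt0P; exists 1%g. Qed.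

Lemma hull_sign_avg : hull (rank1 @` sign_set) sign_avg.
Proof.
apply: hull_fin => [s||s]; first by rewrite invr_ge0 ler0n.
  rewrite sumr_const -[LHS]mulr_natr mulVf ?gt_eqF//.
by exists (sign_col s) => //; right; exists s.
Qed.

Lemma sign_avgE i j : sign_avg i j =
  #|{: 'S_d}|%:R^-1 * \sum_s sign_col s i 0 * sign_col s j 0.
Proof.
rewrite summxE mulr_sumr; apply: eq_bigr => s _.
by rewrite mxE rank1E.
Qed.

Lemma sign_avg_diag i : sign_avg i i = 1.
Proof.
rewrite sign_avgE (eq_bigr (fun=> 1)); last first.
  by move=> s _; rewrite mxE -expr2 sqrr_sign.
by rewrite sumr_const mulVf ?gt_eqF.
Qed.

Lemma sign_avg_perm (t : 'S_d) i j : sign_avg (t i) (t j) = sign_avg i j.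
Proof.
rewrite !sign_avgE; congr (_ * _).
rewrite [RHS](reindex_inj (mulgI t)); apply: eq_bigr => s _.
by rewrite !mxE !permM.
Qed.

(** The symmetric group is doubly transitive: two transpositions carry [(i, j)] to [(k, l)], the
    second one fixing [k]. *)
Lemma sign_avg_off i j k l : i != j -> k != l -> sign_avg i j = sign_avg k l.
Proof.
move=> ij kl; set j' := tperm i k j.
have kj' : k != j' by rewrite -(tpermL i k) (inj_eq perm_inj).
rewrite -(sign_avg_perm (tperm i k * tperm j' l)%g i j) !permM tpermL -/j'.
by rewrite tpermL tpermD// eq_sym.
Qed.

Lemma sign_avg_ones : qform sign_avg (const_mx 1) = (odd d)%:R ^+ 2.
Proof.
rewrite /sign_avg (scalar_sum _ _ (qform_scalar_map _)).
rewrite (eq_bigr (fun=> #|{: 'S_d}|%:R^-1 * (odd d)%:R ^+ 2)).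
  by rewrite sumr_const -[LHS]mulr_natl mulrA divff ?gt_eqF// mul1r.
move=> s _; rewrite qform_rank1 -(sum_sign_col s) mxE.
by congr (_ * _ ^+ 2); apply: eq_bigr => i _; rewrite mxE mul1r.
Qed.

Lemma qform_const_scalar r t v :
  qform (const_mx r + t%:M) v = r * vsum v ^+ 2 + t * sqnorm v.
Proof.
have := qform_scalar_map v 1 (const_mx r) t%:M.
rewrite scale1r mul1r qform_scalar => ->; congr (_ + _).
rewrite qformE expr2 /vsum mulr_suml mulr_sumr; apply: eq_bigr => i _.
by rewrite !mulr_sumr; apply: eq_bigr => j _; rewrite mxE; ring.
Qed.

(** The variance identity. *)
Lemma sqnorm_centered v : (0 < d)%N ->
  sqnorm (v - const_mx (vsum v / d%:R)) = sqnorm v - vsum v ^+ 2 / d%:R.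
Proof.
move=> d0; have dn0 : d%:R != 0 :> R by rewrite pnatr_eq0 -lt0n.
set m := vsum v / d%:R; rewrite !sqnormE.
rewrite (eq_bigr (fun i => v 0 i ^+ 2 - 2 * m * v 0 i + m ^+ 2)); last first.
  by move=> i _; rewrite !mxE; ring.
rewrite !big_split/= sumr_const card_ord -mulr_natl sumrN -mulr_sumr -/(vsum v).
by rewrite /m; field.
Qed.

(** By symmetry [sign_avg] has one off-diagonal value [r], which its value at the all-ones vector, 0
    or 1, determines. As [r] is at most 0, the form dominates the squared norm of the centered
    vector. *)
Lemma sign_avg_ge v : (0 < d)%N ->
  sqnorm v - vsum v ^+ 2 / d%:R <= qform sign_avg v.
Proof.
move=> d0; have d_gt0 : 0 < d%:R :> R by rewrite ltr0n.
have [r Qr r0] : exists2 r, sign_avg = const_mx r + (1 - r)%:M &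
    r = 0 \/ (1 < d)%N.
  have [[[i0 j0] /= ij0]|neq0] := pselect (exists ij : 'I_d * 'I_d, ij.1 != ij.2).
    exists (sign_avg i0 j0).
      apply/matrixP => i j; rewrite !mxE; have [->|ij] := eqVneq i j.
        by rewrite sign_avg_diag mulr1n addrC subrK.
      by rewrite mulr0n addr0; exact: sign_avg_off.
    right; rewrite ltnNge; apply: contra ij0 => d1; rewrite -val_eqE/=.
    have := leq_trans (ltn_ord i0) d1; have := leq_trans (ltn_ord j0) d1.
    by rewrite !ltnS !leqn0 => /eqP -> /eqP ->.
  (* For [d = 1] there is no off-diagonal entry, and [r] is set to 0. *)
  exists 0; last by left.
  apply/matrixP => i j; rewrite !mxE; have [->|ij] := eqVneq i j.
    by rewrite sign_avg_diag subr0 add0r.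
  by exfalso; apply: neq0; exists (i, j).
have := sign_avg_ones; have := sqnorm_ge0 (v - const_mx (vsum v / d%:R)).
rewrite sqnorm_centered// Qr !qform_const_scalar.
have -> : vsum (const_mx 1) = d%:R.
  rewrite /vsum (eq_bigr (fun=> 1)) ?sumr_const ?card_ord// => i _.
  by rewrite mxE.
have -> : sqnorm (const_mx 1 : 'rV[R]_d) = d%:R.
  rewrite sqnormE (eq_bigr (fun=> 1)) ?sumr_const ?card_ord// => i _.
  by rewrite mxE expr1n.
set n : R := d%:R in d_gt0 *; set X := sqnorm v; set S := vsum v.
have odd2 : 0 <= ((odd d)%:R : R) ^+ 2 <= 1.
  by rewrite sqr_ge0 exprn_ile1 ?ler0n ?lern1 ?leq_b1.
move: odd2; move: ((odd d)%:R ^+ 2) => q /andP[q0 q1] Y0 rq.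
have r_le0 : r <= 0.
  case: r0 => [->//|d1]; have n1 : 1 < n by rewrite ltr1n.
  rewrite leNgt; apply/negP => r_gt0.
  have : 0 < r * (n * (n - 1)) by rewrite !mulr_gt0// subr_gt0.
  by lra.
(* This is the eigenvalue of [sign_avg] on the all-ones vector; [1 - r] is the one on its orthogonal
   complement. *)
have nr : 0 <= n * r - r + 1 by rewrite -(pmulr_rge0 _ d_gt0); lra.
rewrite -subr_ge0; set Y := S ^+ 2 / n in Y0 *.
have -> : r * S ^+ 2 + (1 - r) * X - (X - Y) =
    - r * (X - Y) + Y * (n * r - r + 1).
  by rewrite /Y; field; rewrite gt_eqF.
rewrite addr_ge0// mulr_ge0 ?oppr_ge0//.
by rewrite /Y mulr_ge0 ?sqr_ge0// invr_ge0 ltW.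
Qed.

Lemma sign_set_tight : (0 < d)%N -> arm_set sign_set /\
  ((4^-1 * d%:R)%:E * Hstar2 sign_set <= (Cmin sign_set)^-1)%E.
Proof.
move=> d0; split; first exact: sign_set_arm.
have d_gt0 : 0 < d%:R :> R by rewrite ltr0n.
have [c c0 [-> _ [M KM Mc] _]] := CminP d0 sign_set_arm.
have [h [-> _ _ hmin]] := Hstar2P d0 sign_set_arm.
rewrite inver gt_eqF// -EFinM lee_fin.
have cd : c * d%:R <= 1.
  have sq1 : sqnorm (const_mx 1 : 'rV[R]_d) = d%:R.
    rewrite sqnormE (eq_bigr (fun=> 1)) ?sumr_const ?card_ord// => i _.
    by rewrite mxE expr1n.
  rewrite -sq1 (le_trans (Mc _))//.
  apply: (hull_le (qform_scalar_map _) _ KM) => _ [a Aa <-].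
  by rewrite qform_rank1; exact: sign_set_ones.
have h4 : h <= 4.
  (* Half of the mass controls [v 0 i - m] and the other half the mean [m]. *)
  pose N := 2^-1 *: sign_avg + (1 - 2^-1) *: (d%:R^-1)%:M.
  have KN : hull (rank1 @` sign_set) N.
    apply: hull_convex; [lra|exact: hull_sign_avg|].
    by apply: hull_basis_scalar => //; left.
  apply: hmin KN _ => i v.
  have -> : qform N v = 2^-1 * qform sign_avg v + 2^-1 * (d%:R^-1 * sqnorm v).
    rewrite /N (qform_scalar_map v) -[_ *: _%:M]addr0 (qform_scalar_map v).
    have -> : qform 0 v = 0 by rewrite /qform /bform mulmx0 mul0mx mxE.
    by rewrite qform_scalar addr0; congr (_ + _ * _); lra.
  have := sign_avg_ge v d0.
  have := sqr_coord_le_sqnorm (v - const_mx (vsum v / d%:R)) i.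
  have := sqnorm_ge0 (v - const_mx (vsum v / d%:R)).
  rewrite sqnorm_centered// !mxE; set m := vsum v / d%:R.
  have -> : vsum v ^+ 2 / d%:R = d%:R * m ^+ 2.
    by rewrite /m; field; rewrite gt_eqF.
  move: (qform _ v) (sqnorm v) => q X X0 vi Xq.
  have mX : m ^+ 2 <= d%:R^-1 * X by rewrite ler_pdivlMl//; lra.
  (* This square is the gap in [v_i^2 <= 2 (v_i - m)^2 + 2 m^2]; the two terms on the right are at
     most [2 q] and [2 X / d], whence the constant 4. *)
  have := sqr_ge0 (v 0 i - 2 * m); nra.
rewrite -[leRHS]mul1r ler_pdivlMr//; have : h * (d%:R * c) <= 4 * 1; last lra.
rewrite (le_trans (y := 4 * (d%:R * c)))// ?ler_wpM2r ?mulr_ge0 ?(ltW c0) ?ler0n//.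
by rewrite ler_wpM2l// mulrC.
Qed.

End permuted_signs.

Theorem proposition2 (R : realType) :
  (forall (d : nat) (A : set 'cV[R]_d), (0 < d)%N -> arm_set A ->
     [/\ H_values A (Hstar2 A),
         C_values A (Cmin A),
         (Hstar2 A <= (Cmin A)^-1)%E &
         ((Cmin A)^-1 <= d%:R%:E * Hstar2 A)%E]) /\
  (exists c C : R, [/\ 0 < c, 0 < C &
     forall d : nat, (0 < d)%N ->
       (exists A : set 'cV[R]_d,
          arm_set A /\ ((Cmin A)^-1 <= C%:E * Hstar2 A)%E) /\
       (exists A' : set 'cV[R]_d,
          arm_set A' /\ ((Cmin A')^-1 >= (c * d%:R)%:E * Hstar2 A')%E)]).
Proof.
split; first exact: optimal_design_bounds.
exists 4^-1, 1; split => [||d d0]; rewrite ?invr_gt0 ?ltr0n ?ltr01//.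
split; first by exists basis_set; exact: basis_set_tight.
by exists sign_set; exact: sign_set_tight.
Qed.
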